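(* Let $\mu=0$. The linearization of the Routh reduced attitude dynamics of the 3D pendulum $$\ddot\Gamma=-\|\dot\Gamma\|^2\Gamma+\Gamma\times\Sigma\quad\text{on }TS^2$$ at the hanging equilibrium $(\Gamma,\dot\Gamma)=(\Gamma_h,0)$, $\Gamma_h=\rho/\|\rho\|$, can be expressed using the variables $(x_1,x_2,\dot x_1,\dot x_2)\in\mathbb{R}^4$ (with the perturbation $\Delta\Gamma\in T_{\Gamma_h}S^2$ given by $\Delta\Gamma=\widehat\Gamma_hM^{-T}x$, $x=(x_1,x_2,x_3)$, an expression that does not depend on $x_3$) according to $$\ddot x_1+mgl_1x_1=0,\qquad \ddot x_2+mgl_2x_2=0.$$
   Context: $J$ is the symmetric positive definite inertia matrix of the rigid body (body frame, origin at the pivot), $m,g>0$, $\rho\in\mathbb{R}^3$, $\rho\neq0$, is the body-fixed vector from the pivot to the center of mass, $\Gamma\in S^2$ is the gravity direction in the body frame, $\mu\in\mathbb{R}$ is the value of the momentum map (vertical component of angular momentum), and $$\Sigma=b\dot\Gamma+J^{-1}\Big[\big(J(\dot\Gamma\times\Gamma)-bJ\Gamma\big)\times\big((\dot\Gamma\times\Gamma)-b\Gamma\big)+\nu^2J\Gamma\times\Gamma-mg\,\Gamma\times\rho-c\,\dot\Gamma\Big],$$ $$c=\nu\Big\{\mathrm{tr}[J]-2\tfrac{\|J\Gamma\|^2}{\Gamma\cdot J\Gamma}\Big\},\quad b=\frac{J\Gamma\cdot(\dot\Gamma\times\Gamma)}{\Gamma\cdot J\Gamma},\quad \nu=\frac{\mu}{\Gamma\cdot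 J\Gamma}.$$ For $a\in\mathbb{R}^3$, $\widehat a$ is the skew-symmetric matrix with $\widehat a\,b=a\times b$. $M$ is a nonsingular $3\times3$ matrix with $J=MM^T$ and $-\frac{mg}{\|\rho\|}\widehat\rho^{\,2}=M\Lambda M^T$, $\Lambda=\mathrm{diag}(mgl_1,mgl_2,0)$, $l_1,l_2>0$ (such $M$ exists by simultaneous diagonalization). *)

(* Defs.v *)
From HB Require Import structures.
From mathcomp Require Import all_boot all_order all_algebra.
From mathcomp Require Import all_classical all_reals all_analysis.
From mathcomp Require Import ring.

Set Implicit Arguments.
Unset Strict Implicit.
Unset Printing Implicit Defensive.

Import Order.TTheory GRing.Theory Num.Theory.
Import numFieldNormedType.Exports.

Local Open Scope ring_scope.

Definition dot3 (R : realType) (a b : 'cV[R]_3) : R :=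
  \sum_(i < 3) a i 0 * b i 0.

(* Euclidean norm; the library norm [`|a|] on matrices is the sup norm. *)
Definition norm3 (R : realType) (a : 'cV[R]_3) : R := Num.sqrt (dot3 a a).

Definition vec3 (R : realType) (x y z : R) : 'cV[R]_3 :=
  \col_(i < 3) [:: x; y; z]`_i.

Definition cross3 (R : realType) (a b : 'cV[R]_3) : 'cV[R]_3 :=
  vec3 (a 1 0 * b 2%:R 0 - a 2%:R 0 * b 1 0)
       (a 2%:R 0 * b 0 0 - a 0 0 * b 2%:R 0)
       (a 0 0 * b 1 0 - a 1 0 * b 0 0).

Definition hat3 (R : realType) (a : 'cV[R]_3) : 'M[R]_3 :=
  \matrix_(i < 3, j < 3)
    (nth [::] [:: [:: 0; - a 2%:R 0; a 1 0];
                  [:: a 2%:R 0; 0; - a 0 0];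
                  [:: - a 1 0; a 0 0; 0]] i)`_j.

Definition spd (R : realType) (J : 'M[R]_3) : Prop :=
  J^T = J /\ (forall v : 'cV[R]_3, v != 0 -> 0 < dot3 v (J *m v)).

Section RouthReduced.
Variables (R : realType) (m g : R) (J : 'M[R]_3) (rho : 'cV[R]_3) (mu : R).
Implicit Types G W : 'cV[R]_3.

Definition routh_nu G : R := mu / dot3 G (J *m G).

Definition routh_b G W : R :=
  dot3 (J *m G) (cross3 W G) / dot3 G (J *m G).

Definition routh_c G : R :=
  routh_nu G * (\tr J - 2 * (norm3 (J *m G) ^+ 2 / dot3 G (J *m G))).

Definition routh_Sigma G W : 'cV[R]_3 :=
  let b := routh_b G W in
  b *: W +
  invmx J *m
    (cross3 (J *m cross3 W G - b *: (J *m G)) (cross3 W G - b *: G)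
     + routh_nu G ^+ 2 *: cross3 (J *m G) G
     - (m * g) *: cross3 G rho
     - routh_c G *: W).

(* The formula is read on the whole ambient space R^3 x R^3, where it is smooth
   near TS^2 when J is positive definite. *)
Definition routh_acc (p : 'cV[R]_3 * 'cV[R]_3) : 'cV[R]_3 :=
  - (norm3 p.2 ^+ 2) *: p.1 + cross3 p.1 (routh_Sigma p.1 p.2).

End RouthReduced.

Definition hanging (R : realType) (rho : 'cV[R]_3) : 'cV[R]_3 :=
  (norm3 rho)^-1 *: rho.

Definition TS2 (R : realType) (p : 'cV[R]_3 * 'cV[R]_3) : Prop :=
  norm3 p.1 = 1 /\ dot3 p.1 p.2 = 0.

(* Tangent space of TS^2 at p = (Gamma, Gammadot): the kernel of the derivative
   of the constraints Gamma . Gamma = 1 and Gamma . Gammadot = 0. *)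
Definition tangent_TS2 (R : realType) (p u : 'cV[R]_3 * 'cV[R]_3) : Prop :=
  dot3 p.1 u.1 = 0 /\ dot3 u.1 p.2 + dot3 p.1 u.2 = 0.

(* [d] solves the linearization at the equilibrium [p] of the second-order
   dynamics Gamma'' = F (Gamma, Gamma') on TS^2: (d, d') is a curve in the
   tangent space of TS^2 at p satisfying d'' = DF(p)(d, d').  For F such that
   (Gamma, Gammadot) |-> (Gammadot, F (Gamma, Gammadot)) is tangent to TS^2
   (see [routh_field_tangent]), the restriction of the derivative to that
   tangent space depends only on F on TS^2.  ['d F p] is meaningful only when
   F is differentiable at p. *)
Definition linearized_solution (R : realType)
    (F : 'cV[R]_3 * 'cV[R]_3 -> 'cV[R]_3) (p : 'cV[R]_3 * 'cV[R]_3)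
    (d : R -> 'cV[R]_3) : Prop :=
  forall t : R,
    [/\ tangent_TS2 p (d t, (d^`())%classic t),
        derivable d t 1,
        derivable (d^`())%classic t 1
      & ((d^`())^`())%classic t = 'd F p (d t, (d^`())%classic t)].

Definition oscillator_solution (R : realType) (k : R) (y : R -> R) : Prop :=
  forall t : R,
    [/\ derivable y t 1,
        derivable (y^`())%classic t 1
      & ((y^`())^`())%classic t + k * y t = 0].

Definition perturbation (R : realType) (rho : 'cV[R]_3) (M : 'M[R]_3)
    (x : 'cV[R]_3) : 'cV[R]_3 :=
  hat3 (hanging rho) *m (invmx M)^T *m x.

Lemma sum3 (R : realType) (f : 'I_3 -> R) :
  \sum_(i < 3) f i = f 0 + f 1 + f 2%:R.
Proof.
rewrite !big_ord_recl big_ord0 addr0 addrA.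
by congr (f _ + f _ + f _); apply: val_inj.
Qed.

Lemma hat3E (R : realType) (a b : 'cV[R]_3) : hat3 a *m b = cross3 a b.
Proof.
apply/matrixP => i j; rewrite (ord1 j) {j} !mxE sum3 !mxE /=.
by case: i => [[|[|[|//]]] Hi] /=; ring.
Qed.

Lemma norm3_sqr (R : realType) (a : 'cV[R]_3) : norm3 a ^+ 2 = dot3 a a.
Proof.
by rewrite sqr_sqrtr //; apply: sumr_ge0 => i _; rewrite -expr2 sqr_ge0.
Qed.

Lemma routh_field_tangent (R : realType) (m g : R) (J : 'M[R]_3)
    (rho : 'cV[R]_3) (mu : R) (p : 'cV[R]_3 * 'cV[R]_3) :
  TS2 p -> tangent_TS2 p (p.2, routh_acc m g J rho mu p).
Proof.
case: p => G W [/= hG hGW]; split => //=.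
have hGG : dot3 G G = 1 by rewrite -norm3_sqr hG expr1n.
rewrite /routh_acc /= norm3_sqr; set S := routh_Sigma _ _ _ _ _ _ _.
have -> : dot3 G (- dot3 W W *: G + cross3 G S) = - dot3 W W * dot3 G G.
  by rewrite /cross3 /vec3 {1}/dot3 sum3 !mxE /= [dot3 G G]sum3; ring.
by rewrite hGG mulr1 subrr.
Qed.

Lemma hanging_equilibrium (R : realType) (m g : R) (J : 'M[R]_3)
    (rho : 'cV[R]_3) :
  routh_acc m g J rho 0 (hanging rho, 0) = 0.
Proof.
have c0 (a : 'cV[R]_3) : cross3 0 a = 0.
  apply/matrixP => i j; rewrite !mxE !mul0r subrr.
  by case: i => [[|[|[|//]]] Hi].
have cZ (k : R) (a : 'cV[R]_3) : cross3 (k *: a) a = 0.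
  apply/matrixP => i j; rewrite !mxE.
  by case: i => [[|[|[|//]]] Hi] /=; ring.
have cr0 (a : 'cV[R]_3) : cross3 a 0 = 0.
  apply/matrixP => i j; rewrite !mxE !mulr0 subrr.
  by case: i => [[|[|[|//]]] Hi].
have d0 (a : 'cV[R]_3) : dot3 a 0 = 0.
  by rewrite /dot3 big1 // => i _; rewrite mxE mulr0.
rewrite /routh_acc /routh_Sigma /routh_b /routh_c /routh_nu /= norm3_sqr.
by rewrite !c0 !d0 !mul0r !scale0r mulmx0 subrr c0 /hanging cZ expr0n !scaler0
  scale0r !subr0 addr0 mulmx0 addr0 cr0 oppr0 scale0r addr0.
Qed.

(* Main.v *)
(* Write G for rho / |rho|.  At (G, 0) every term of Sigma other than the
   gravity torque is quadratic in the velocity and Sigma itself vanishes, so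
   that DF(G, 0)(a, w) = mg G x J^-1 (rho x a).  With J = M M^T and
   a = P x = G x M^-T x, the factor M^-T of J^-1 reproduces P, and what remains
   is M^-1 (-mg rho x P x) = Lambda x by the choice of M; hence
   DF(G, 0)(P x, P v) = - P (Lambda x).  The kernel of P is that of Lambda,
   since the cross product with G is injective on the tangent plane, so P can be
   cancelled in the first two coordinates. *)
Require Import Defs.
From HB Require Import structures.
From mathcomp Require Import all_boot all_order all_algebra.
From mathcomp Require Import all_classical all_reals all_analysis.
From mathcomp Require Import ring.

Import Order.TTheory GRing.Theory Num.Theory.
Import numFieldNormedType.Exports.

Local Open Scope ring_scope.

Set Implicit Arguments.
Unset Strict Implicit.
Unset Printing Implicit Defensive.

(** * Differential calculus for matrix-valued maps *)

Lemma is_diff_coord (R : realType) (V : normedModType R) (m n : nat)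
    (f df : V -> 'M[R]_(m, n)) (x : V) i j :
  is_diff x f df -> is_diff x (fun y => f y i j) (fun y => df y i j).
Proof.
move=> fx; pose c (N : 'M[R]_(m, n)) : R := N i j.
have clin : linear c by move=> k a b; rewrite /c !mxE.
pose cM := GRing.isLinear.Build _ _ _ _ _ clin.
pose cL : {linear 'M[R]_(m, n) -> R} := HB.pack c cM.
have cc : continuous cL by exact: coord_continuous.
have dc : is_diff (f x) c c.
  apply: DiffDef; first exact: (@linear_differentiable _ _ _ cL).
  by rewrite -[c]/(cL : _ -> _) diff_lin.
exact: (is_diff_comp fx dc).
Qed.

Lemma is_diff_sum (R : realType) (V W : normedModType R) (I : Type)
    (r : seq I) (f df : I -> V -> W) (x : V) :
  (forall i, is_diff x (f i) (df i)) ->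
  is_diff x (fun y => \sum_(i <- r) f i y) (fun y => \sum_(i <- r) df i y).
Proof.
move=> fx; elim: r => [|i r IHr].
  under eq_fun do rewrite big_nil.
  under [X in is_diff _ _ X]eq_fun do rewrite big_nil.
  exact: is_diff_cst.
under eq_fun do rewrite big_cons.
under [X in is_diff _ _ X]eq_fun do rewrite big_cons.
exact: is_diffD.
Qed.

(** A matrix is the finite sum of its entries times the elementary matrices [delta_mx i j], so the
    product rules below reduce to scalar ones. *)
Lemma is_diff_mx (R : realType) (V : normedModType R) (m n : nat)
    (f df : V -> 'M[R]_(m, n)) (x : V) :
  (forall i j, is_diff x (fun y => f y i j) (fun y => df y i j)) ->
  is_diff x f df.
Proof.
move=> fx.
have sumE (h : V -> 'M[R]_(m, n)) :
    h = fun y => \sum_i \sum_j h y i j *: delta_mx i j.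
  by apply/funext => y; exact: matrix_sum_delta.
rewrite (sumE f) (sumE df); apply: is_diff_sum => i; apply: is_diff_sum => j.
exact: (is_diff_comp (fx i j) (is_diff_scalel _ _)).
Qed.

Lemma is_diff_scale (R : realType) (V : normedModType R) (m n : nat)
    (k dk : V -> R) (f df : V -> 'M[R]_(m, n)) (x : V) :
  is_diff x k dk -> is_diff x f df ->
  is_diff x (fun y => k y *: f y) (fun y => dk y *: f x + k x *: df y).
Proof.
move=> kx fx; apply: is_diff_mx => i j.
have := is_diffM kx (is_diff_coord i j fx).
rewrite (_ : _ * _ = fun y => (k y *: f y) i j); last first.
  by apply/funext => y; rewrite mxE.
by move/is_diff_eq; apply; apply/funext => y; rewrite !fctE !mxE /= addrC mulrC.
Qed.

Lemma is_diff_mulmx (R : realType) (V : normedModType R) (m n q : nat)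
    (f df : V -> 'M[R]_(m, n)) (g dg : V -> 'M[R]_(n, q)) (x : V) :
  is_diff x f df -> is_diff x g dg ->
  is_diff x (fun y => f y *m g y) (fun y => df y *m g x + f x *m dg y).
Proof.
move=> fx gx; apply: is_diff_mx => i j.
have := is_diff_sum (index_enum 'I_n)
  (fun k => is_diffM (is_diff_coord i k fx) (is_diff_coord k j gx)).
rewrite (_ : (fun y => _) = fun y => (f y *m g y) i j); last first.
  by apply/funext => y; rewrite mxE.
move/is_diff_eq; apply; apply/funext => y; rewrite !mxE -big_split /=.
by apply: eq_bigr => k _; rewrite !fctE addrC mulrC.
Qed.

Lemma is_diff_mulmxl (R : realType) (V : normedModType R) (m n q : nat)
    (A : 'M[R]_(m, n)) (f df : V -> 'M[R]_(n, q)) (x : V) :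
  is_diff x f df -> is_diff x (fun y => A *m f y) (fun y => A *m df y).
Proof.
move=> fx; apply: (is_diff_eq (is_diff_mulmx (is_diff_cst A x) fx)).
by apply/funext => y /=; rewrite mul0mx add0r.
Qed.

Lemma is_diff_hat3 (R : realType) (V : normedModType R)
    (f df : V -> 'cV[R]_3) (x : V) :
  is_diff x f df -> is_diff x (fun y => hat3 (f y)) (fun y => hat3 (df y)).
Proof.
move=> fx; apply: is_diff_mx => i j.
have c k : is_diff x (fun y => f y k 0) (fun y => df y k 0).
  exact: is_diff_coord.
have cN k : is_diff x (fun y => - f y k 0) (fun y => - df y k 0).
  exact: is_diffN.
have c0 : is_diff x (fun=> 0 : R) (fun=> 0) by exact: is_diff_cst.
case: i => [[|[|[|//]]] Hi]; case: j => [[|[|[|//]]] Hj].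
all: under eq_fun do rewrite mxE /=.
all: under [X in is_diff _ _ X]eq_fun do rewrite mxE /=.
all: solve [exact: c0 | exact: c | exact: cN].
Qed.

(** Through [hat3E] the cross product becomes a matrix product, and its Leibniz rule is that of
    [is_diff_mulmx]. *)
Lemma is_diff_cross3 (R : realType) (V : normedModType R)
    (f df g dg : V -> 'cV[R]_3) (x : V) :
  is_diff x f df -> is_diff x g dg ->
  is_diff x (fun y => cross3 (f y) (g y))
    (fun y => cross3 (df y) (g x) + cross3 (f x) (dg y)).
Proof.
move=> fx gx; have := is_diff_mulmx (is_diff_hat3 fx) gx.
under eq_fun do rewrite hat3E.
by under [X in is_diff _ _ X]eq_fun do rewrite !hat3E.
Qed.

Lemma is_diff_dot3 (R : realType) (V : normedModType R)
    (f df g dg : V -> 'cV[R]_3) (x : V) :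
  is_diff x f df -> is_diff x g dg ->
  is_diff x (fun y => dot3 (f y) (g y))
    (fun y => dot3 (df y) (g x) + dot3 (f x) (dg y)).
Proof.
move=> fx gx.
have := is_diff_sum (index_enum 'I_3)
  (fun k => is_diffM (is_diff_coord k 0 fx) (is_diff_coord k 0 gx)).
move/is_diff_eq; apply; apply/funext => y; rewrite -big_split /=.
by apply: eq_bigr => k _; rewrite !fctE addrC mulrC.
Qed.

Lemma is_diff_fst (R : realType) (V W : normedModType R) (x : V * W) :
  is_diff x fst fst.
Proof.
have cfst : continuous (fst : {linear (V * W)%type -> V}).
  by move=> y; exact: cvg_fst.
by apply: DiffDef; [exact: linear_differentiable | rewrite diff_lin].
Qed.

Lemma is_diff_snd (R : realType) (V W : normedModType R) (x : V * W) :
  is_diff x snd snd.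
Proof.
have csnd : continuous (snd : {linear (V * W)%type -> W}).
  by move=> y; exact: cvg_snd.
by apply: DiffDef; [exact: linear_differentiable | rewrite diff_lin].
Qed.

(** * Derivatives of curves of matrices *)

Lemma is_derive_mx (R : realType) (m n : nat) (f : R -> 'M[R]_(m, n))
    (df : 'M[R]_(m, n)) (t : R) :
  (forall i j, is_derive t 1 (fun s => f s i j) (df i j)) -> is_derive t 1 f df.
Proof.
move=> fx; have fd : derivable f t 1
  by apply: (derivable_mxP f t 1).2 => i j; exact: ex_derive.
apply: DeriveDef => //; rewrite derive_mx //.
by apply/matrixP => i j; rewrite mxE; exact: derive_val.
Qed.

Lemma is_derive_coord (R : realType) (m n : nat) (f : R -> 'M[R]_(m, n))
    (df : 'M[R]_(m, n)) (t : R) i j :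
  is_derive t 1 f df -> is_derive t 1 (fun s => f s i j) (df i j).
Proof.
move=> [fd <-]; apply: DeriveDef; first exact: (derivable_mxP f t 1).1.
by rewrite derive_mx // mxE.
Qed.

Lemma is_derive_mulmxl (R : realType) (m n q : nat) (A : 'M[R]_(m, n))
    (f : R -> 'M[R]_(n, q)) (df : 'M[R]_(n, q)) (t : R) :
  is_derive t 1 f df -> is_derive t 1 (fun s => A *m f s) (A *m df).
Proof.
move=> fx; apply: is_derive_mx => i j.
have := @is_derive_sum _ _ _ n (fun k s => A i k *: (f s k j : R)) t 1
  (fun k => A i k *: df k j) _.
rewrite (_ : \sum_(k < n) _ = fun s => (A *m f s) i j); last first.
  by apply/funext => s; rewrite fct_sumE mxE.
rewrite mxE; apply => k.
exact: (is_deriveZ _ (is_derive_coord k j fx)).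
Qed.

(** * Vector algebra in three dimensions *)

Lemma hat3Z (R : realType) (k : R) (a : 'cV[R]_3) : hat3 (k *: a) = k *: hat3 a.
Proof.
apply/matrixP => i j; rewrite !mxE.
case: i => [[|[|[|//]]] Hi]; case: j => [[|[|[|//]]] Hj] /=.
all: ring.
Qed.

Lemma cross30l (R : realType) (a : 'cV[R]_3) : cross3 0 a = 0.
Proof.
have := hat3Z 0 (0 : 'cV[R]_3); rewrite !scale0r -hat3E => ->.
by rewrite mul0mx.
Qed.

Lemma cross30r (R : realType) (a : 'cV[R]_3) : cross3 a 0 = 0.
Proof. by rewrite -hat3E mulmx0. Qed.

Lemma cross3aa (R : realType) (a : 'cV[R]_3) : cross3 a a = 0.
Proof.
apply/matrixP => -[[|[|[|//]]] Hi] j; rewrite !mxE /=.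
all: ring.
Qed.

Lemma cross3C (R : realType) (a b : 'cV[R]_3) : cross3 a b = - cross3 b a.
Proof.
apply/matrixP => -[[|[|[|//]]] Hi] j; rewrite !mxE /=.
all: ring.
Qed.

Lemma dot30l (R : realType) (a : 'cV[R]_3) : dot3 0 a = 0.
Proof. by rewrite /dot3 big1 // => i _; rewrite mxE mul0r. Qed.

Lemma dot3C (R : realType) (a b : 'cV[R]_3) : dot3 a b = dot3 b a.
Proof. by apply: eq_bigr => i _; rewrite mulrC. Qed.

Lemma dot30r (R : realType) (a : 'cV[R]_3) : dot3 a 0 = 0.
Proof. by rewrite dot3C dot30l. Qed.

Lemma norm3_gt0 (R : realType) (a : 'cV[R]_3) : a != 0 -> 0 < norm3 a.
Proof.
move=> a0; have ge0 i : 0 <= a i 0 * a i 0 by rewrite -expr2 sqr_ge0.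
rewrite sqrtr_gt0 lt_def sumr_ge0 // andbT; apply: contra a0 => /eqP aa0.
apply/eqP/matrixP => i j; rewrite (ord1 j) mxE; apply/eqP.
have /eqP : a i 0 * a i 0 = 0 by apply: (psumr_eq0P _ aa0) => // k _.
by rewrite mulf_eq0 orbb.
Qed.

Lemma norm3Z (R : realType) (k : R) (a : 'cV[R]_3) :
  0 <= k -> norm3 (k *: a) = k * norm3 a.
Proof.
move=> k0; rewrite /norm3 (_ : dot3 _ _ = k ^+ 2 * dot3 a a).
  by rewrite sqrtrM ?sqr_ge0 // sqrtr_sqr ger0_norm.
by rewrite mulr_sumr; apply: eq_bigr => i _; rewrite !mxE; ring.
Qed.

Lemma dot3_cross3 (R : realType) (a b : 'cV[R]_3) : dot3 a (cross3 a b) = 0.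
Proof. by rewrite /dot3 sum3 !mxE /=; ring. Qed.

Lemma cross3_cross3 (R : realType) (a b : 'cV[R]_3) :
  cross3 a (cross3 b a) = dot3 a a *: b - dot3 a b *: a.
Proof.
apply/matrixP => i j; rewrite !(ord1 j, mxE) /dot3 !sum3.
case: i => [[|[|[|//]]] Hi] /=.
- by rewrite (_ : Ordinal Hi = 0); [ring | exact: val_inj].
- by rewrite (_ : Ordinal Hi = 1); [ring | exact: val_inj].
- by rewrite (_ : Ordinal Hi = 2%:R); [ring | exact: val_inj].
Qed.

(** * The differential of the reduced acceleration *)

(** The differential is assembled term by term from the product rules, then evaluated at zero
    velocity, where nearly every factor vanishes. The center of mass is taken parallel to G so that
    the gravity torque vanishes there too. *)
Lemma is_diff_routh_acc (R : realType) (m g k : R) (J : 'M[R]_3)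
    (G : 'cV[R]_3) :
  dot3 G (J *m G) != 0 ->
  is_diff (G, 0 : 'cV[R]_3) (routh_acc m g J (k *: G) 0)
    (fun u => cross3 G (invmx J *m - ((m * g) *: cross3 u.1 (k *: G)))).
Proof.
set p := (G, _); set rho := k *: G => D0.
have dG : is_diff p fst fst := is_diff_fst p.
have dW : is_diff p snd snd := is_diff_snd p.
have dJG := is_diff_mulmxl J dG.
have dWG := is_diff_cross3 dW dG.
have [dD _] := is_diff_dot3 dG dJG.
have dN := is_diff_dot3 dJG dWG.
(* The differential of the inverse denominator may stay abstract: in [db] it is multiplied by the
   numerator of [routh_b], which is zero at zero velocity. *)
have /differentiableP dV := differentiableV dD D0.
have db := is_diffM dN dV.
have dX := is_diffB (is_diff_mulmxl J dWG) (is_diff_scale db dJG).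
have dY := is_diffB dWG (is_diff_scale db dG).
have dT : is_diff p (fun q => (m * g) *: cross3 q.1 rho)
    (fun u => (m * g) *: cross3 u.1 rho).
  have := is_diffZ (m * g) (is_diff_cross3 dG (is_diff_cst rho p)).
  move/is_diff_eq; apply.
  by apply/funext => u; rewrite !fctE /= cross30r addr0.
have dS := is_diffD (is_diff_scale db dW)
  (is_diff_mulmxl (invmx J) (is_diffB (is_diff_cross3 dX dY) dT)).
have dF := is_diffD (is_diff_scale (is_diffN (is_diff_dot3 dW dW)) dG)
  (is_diff_cross3 dG dS).
clear -dF.
set F := _ + _ in dF; set dF' := _ + _ in dF.
(* At zero momentum [routh_nu] is 0, so the terms of Sigma in nu^2 and c, left out of the composite,
   contribute nothing. *)
have <- : F = routh_acc m g J rho 0.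
  apply/funext => -[G' W]; rewrite /F /routh_acc /routh_Sigma /routh_b /routh_c.
  by rewrite /routh_nu norm3_sqr !fctE /= !mul0r expr0n !scale0r addr0 subr0.
apply: (is_diff_eq dF); apply/funext => u; rewrite /dF' !fctE /=.
(* Hence Sigma is zero at [p], and the Leibniz rule for G x Sigma keeps only G x dSigma. *)
have G0 : cross3 G rho = 0.
  by rewrite /rho -hat3E -scalemxAr hat3E cross3aa scaler0.
rewrite G0 !cross30l !dot30r !dot30l !(mul0r, scale0r, scaler0, mulmx0, addr0).
by rewrite !(subr0, cross30l, cross30r, mulmx0, addr0, add0r, oppr0, scale0r).
Qed.

(** * Coordinates on the tangent space at the hanging equilibrium *)

Section HangingEquilibrium.
Variables (R : realType) (rho : 'cV[R]_3).
Hypothesis rho0 : rho != 0.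

Let n_gt0 : 0 < norm3 rho := norm3_gt0 rho0.

Lemma norm3_hangingZ : norm3 rho *: hanging rho = rho.
Proof. by rewrite scalerA divff ?scale1r // gt_eqF. Qed.

Lemma norm3_hanging : norm3 (hanging rho) = 1.
Proof. by rewrite norm3Z ?invr_ge0 ?ltW // mulVf // gt_eqF. Qed.

Lemma tangent_TS2_hanging (u : 'cV[R]_3 * 'cV[R]_3) :
  tangent_TS2 (hanging rho, 0) u <->
  dot3 (hanging rho) u.1 = 0 /\ dot3 (hanging rho) u.2 = 0.
Proof. by rewrite /tangent_TS2 /= dot30r add0r. Qed.

(** By the triple product expansion with a unit vector, the cross product with [hanging rho] is
    invertible on the plane orthogonal to it. Both the surjectivity of [perturbation] and its kernel
    rest on this. *)
Lemma cross3_hanging_orth (a : 'cV[R]_3) :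
  dot3 (hanging rho) a = 0 -> cross3 (hanging rho) (cross3 a (hanging rho)) = a.
Proof.
move=> a0; rewrite cross3_cross3 a0 scale0r subr0 -norm3_sqr norm3_hanging.
by rewrite expr1n scale1r.
Qed.

Lemma is_diff_routh_acc_hanging (m g : R) (J : 'M[R]_3) : spd J ->
  is_diff (hanging rho, 0 : 'cV[R]_3) (routh_acc m g J rho 0)
    (fun u => cross3 (hanging rho) (invmx J *m ((m * g) *: cross3 rho u.1))).
Proof.
move=> [_ Jpos]; have G0 : hanging rho != 0.
  by apply: contra_neq rho0 => G0; rewrite -norm3_hangingZ G0 scaler0.
have := @is_diff_routh_acc R m g (norm3 rho) J (hanging rho).
rewrite norm3_hangingZ => /(_ (lt0r_neq0 (Jpos _ G0)))/is_diff_eq; apply.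
by apply/funext => u; rewrite [cross3 u.1 _]cross3C scalerN opprK.
Qed.

Variable M : 'M[R]_3.
Implicit Types x y : 'cV[R]_3.

Lemma perturbationE x :
  perturbation rho M x = cross3 (hanging rho) ((invmx M)^T *m x).
Proof. by rewrite -hat3E mulmxA. Qed.

Lemma perturbation_tangent x : dot3 (hanging rho) (perturbation rho M x) = 0.
Proof. by rewrite perturbationE dot3_cross3. Qed.

Hypothesis Mu : M \in unitmx.

(** The preimage solves M^-T x = a x G, with G the hanging direction. *)
Lemma perturbation_onto (a : 'cV[R]_3) : dot3 (hanging rho) a = 0 ->
  perturbation rho M (M^T *m cross3 a (hanging rho)) = a.
Proof.
move=> a0; rewrite perturbationE mulmxA -trmx_mul mulmxV // trmx1 mul1mx.
exact: cross3_hanging_orth.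
Qed.

Variables (k a b : R).
Hypotheses (k0 : k != 0) (a0 : a != 0) (b0 : b != 0).
(** This is Lambda: [a], [b] stand for mgl_1, mgl_2, and [k] for mg. *)
Let L := diag_mx (vec3 a b 0)^T.
Hypothesis hL : - (k / norm3 rho) *: (hat3 rho *m hat3 rho) = M *m L *m M^T.

Lemma stiffness_coordE x i : (L *m x) i 0 = vec3 a b 0 i 0 * x i 0.
Proof. by rewrite mul_diag_mx !mxE. Qed.

(** The factor 1/|rho| inside [hanging] produces the normalized square of [hat3 rho] in [hL]; then
    M^-1 and M^-T cancel the outer factors of M L M^T. *)
Lemma stiffness_perturbation x :
  invmx M *m (- k *: cross3 rho (perturbation rho M x)) = L *m x.
Proof.
have -> : - k *: cross3 rho (perturbation rho M x) =
    (- (k / norm3 rho) *: (hat3 rho *m hat3 rho)) *m ((invmx M)^T *m x).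
  rewrite /perturbation /hanging hat3Z -hat3E -!scalemxAl -scalemxAr scalerA.
  by rewrite mulNr !mulmxA.
rewrite hL -!mulmxA mulKmx // [M^T *m _]mulmxA -trmx_mul mulVmx //.
by rewrite trmx1 mul1mx.
Qed.

Lemma perturbation_eq0 x : perturbation rho M x = 0 <-> L *m x = 0.
Proof.
rewrite -stiffness_perturbation; split => [->|].
  by rewrite cross30r scaler0 mulmx0.
move/(congr1 (mulmx M)); rewrite mulKVmx // mulmx0 => /eqP.
rewrite scaler_eq0 oppr_eq0 (negbTE k0) /= => /eqP rP0.
(* A tangent vector is recovered from its cross product with the hanging direction, here zero
   because rho x P x = 0. *)
rewrite -[LHS]cross3_hanging_orth ?perturbation_tangent //.
rewrite [X in cross3 _ X]cross3C -(hat3E (hanging rho) (perturbation rho M x)).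
by rewrite [hat3 _]hat3Z -scalemxAl hat3E rP0 scaler0 oppr0 cross30r.
Qed.

(** By linearity this is a statement about the kernel, which is that of [L]: the third axis, as only
    the last diagonal entry is zero. *)
Lemma perturbation_eqP x y :
  perturbation rho M x = perturbation rho M y <->
  x 0 0 = y 0 0 /\ x 1 0 = y 1 0.
Proof.
have PB : perturbation rho M (x - y) =
    perturbation rho M x - perturbation rho M y.
  exact: mulmxBr.
split => [xy | [xy0 xy1]].
  have /perturbation_eq0 L0 : perturbation rho M (x - y) = 0.
    by rewrite PB xy subrr.
  split; apply/subr0_eq.
    have /eqP := congr1 (fun A : 'cV[R]_3 => A 0 0) L0.
    by rewrite stiffness_coordE !mxE /= mulf_eq0 (negbTE a0) => /eqP.
  have /eqP := congr1 (fun A : 'cV[R]_3 => A 1 0) L0.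
  by rewrite stiffness_coordE !mxE /= mulf_eq0 (negbTE b0) => /eqP.
apply/subr0_eq; rewrite -PB; apply/perturbation_eq0.
apply/matrixP => i j; rewrite (ord1 j) stiffness_coordE !mxE.
case: i => [[|[|[|//]]] Hi] /=; last by rewrite mul0r.
- by rewrite (_ : Ordinal Hi = 0) ?xy0 ?subrr ?mulr0 //; exact: val_inj.
- by rewrite (_ : Ordinal Hi = 1) ?xy1 ?subrr ?mulr0 //; exact: val_inj.
Qed.

(** Since J^-1 = M^-T M^-1, the factor M^-1 completes the stiffness identity while M^-T, together
    with the outer cross product, rebuilds [perturbation]. *)
Lemma diff_routh_acc_perturbation (m g : R) (J : 'M[R]_3) x v :
  spd J -> J = M *m M^T -> k = m * g ->
  'd (routh_acc m g J rho 0) (hanging rho, 0 : 'cV[R]_3)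
    (perturbation rho M x, perturbation rho M v) =
  perturbation rho M (- (L *m x)).
Proof.
move=> Jspd JE kE; have [_ ->] := is_diff_routh_acc_hanging m g Jspd.
rewrite [RHS]perturbationE -stiffness_perturbation scaleNr !mulmxN opprK -kE.
have MTu : M^T \in unitmx by rewrite unitmx_tr.
have -> : invmx J = invmx M^T *m invmx M by rewrite JE; exact: invrM.
by rewrite trmx_inv mulmxA.
Qed.

(** [x3] may fail to be differentiable and [z] is arbitrary: both are replaced by 0, which leaves
    the perturbation unchanged. *)
Lemma is_derive_perturbation (x1 x2 x3 : R -> R) (t d1 d2 z : R) :
  is_derive t 1 x1 d1 -> is_derive t 1 x2 d2 ->
  is_derive t 1 (fun s => perturbation rho M (vec3 (x1 s) (x2 s) (x3 s)))
    (perturbation rho M (vec3 d1 d2 z)).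
Proof.
move=> dx1 dx2.
have -> : perturbation rho M (vec3 d1 d2 z) = perturbation rho M (vec3 d1 d2 0).
  by apply/perturbation_eqP; rewrite !mxE.
under eq_fun => s.
  have -> : perturbation rho M (vec3 (x1 s) (x2 s) (x3 s)) =
      perturbation rho M (vec3 (x1 s) (x2 s) 0).
    by apply/perturbation_eqP; rewrite !mxE.
  over.
apply: is_derive_mulmxl; apply: is_derive_mx => i j.
under eq_fun do rewrite mxE; rewrite mxE.
case: i => [[|[|[|//]]] Hi] /=; [exact: dx1 | exact: dx2 |].
exact: is_derive_cst.
Qed.

(** Regularity passes back to the coordinates: the constant matrix M^-1 (-k [hat3 rho]) sends P x to
    L x, whose first two entries are a x_1 and b x_2. *)
Lemma derivable_perturbation (x1 x2 x3 : R -> R) (t : R) :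
  derivable (fun s => perturbation rho M (vec3 (x1 s) (x2 s) (x3 s))) t 1 ->
  derivable x1 t 1 /\ derivable x2 t 1.
Proof.
move=> /derivableP dP.
have := is_derive_mulmxl (invmx M *m (- k *: hat3 rho)) dP.
under eq_fun do
  rewrite -mulmxA -scalemxAl hat3E stiffness_perturbation.
move=> dL; split.
  have := is_deriveZ a^-1 (is_derive_coord 0 0 dL).
  rewrite (_ : _ \*: _ = x1); first by move=> [].
  by apply/funext => s; rewrite /= stiffness_coordE !mxE /= [LHS]mulKf.
have := is_deriveZ b^-1 (is_derive_coord 1 0 dL).
rewrite (_ : _ \*: _ = x2); first by move=> [].
by apply/funext => s; rewrite /= stiffness_coordE !mxE /= [LHS]mulKf.
Qed.

End HangingEquilibrium.

(** * Equivalence with the two oscillators *)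

Unset Implicit Arguments.

Theorem proposition21 (R : realType) (m g l1 l2 mu : R) (J M : 'M[R]_3)
    (rho : 'cV[R]_3)
    (hm : 0 < m) (hg : 0 < g) (hl1 : 0 < l1) (hl2 : 0 < l2)
    (hJ : spd J) (hrho : rho != 0)
    (hM : M \in unitmx)
    (hJM : J = M *m M^T)
    (hLambda : - (m * g / norm3 rho) *: (hat3 rho *m hat3 rho)
       = M *m diag_mx (vec3 (m * g * l1) (m * g * l2) 0)^T *m M^T)
    (hmu : mu = 0) :
  let F := routh_acc m g J rho mu in
  let p := (hanging rho, 0 : 'cV[R]_3) in
  let P := perturbation rho M in
  (* the reduced dynamics can be linearized at the hanging equilibrium *)
  differentiable F p /\
  (* (x_1, x_2, v_1, v_2) are linear coordinates on the tangent space of TS^2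
     at p through (Delta Gamma, Delta Gammadot) = (P x, P v), and P x does not
     depend on x_3 *)
  (forall x v : 'cV[R]_3, tangent_TS2 p (P x, P v)) /\
  (forall u : 'cV[R]_3 * 'cV[R]_3, tangent_TS2 p u ->
     exists x v : 'cV[R]_3, u = (P x, P v)) /\
  (forall x y : 'cV[R]_3, P x = P y <-> x 0 0 = y 0 0 /\ x 1 0 = y 1 0) /\
  (* along a curve, the velocity coordinates are the time derivatives *)
  (forall (x1 x2 x3 : R -> R) (t z : R), derivable x1 t 1 -> derivable x2 t 1 ->
     let d := fun s => P (vec3 (x1 s) (x2 s) (x3 s)) in
     derivable d t 1 /\
     (d^`())%classic t = P (vec3 ((x1^`())%classic t) ((x2^`())%classic t) z)) /\
  (* the linearized equations in these coordinates *)
  (forall x1 x2 x3 : R -> R,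
     linearized_solution F p (fun t => P (vec3 (x1 t) (x2 t) (x3 t))) <->
     oscillator_solution (m * g * l1) x1 /\ oscillator_solution (m * g * l2) x2).
Proof.
move=> F p P; rewrite /F {F} hmu.
have k0 : m * g != 0 by rewrite !mulf_neq0 ?gt_eqF.
have a0 : m * g * l1 != 0 by rewrite !mulf_neq0 ?gt_eqF.
have b0 : m * g * l2 != 0 by rewrite !mulf_neq0 ?gt_eqF.
have P_eqP := perturbation_eqP hrho hM k0 a0 b0 hLambda.
have dP := is_derive_perturbation hrho hM k0 a0 b0 hLambda.
have derP := derivable_perturbation hM a0 b0 hLambda.
have DF x v := diff_routh_acc_perturbation hrho hM hLambda
  x v hJ hJM erefl.
have P_tangent x v : tangent_TS2 p (P x, P v).
  by apply/tangent_TS2_hanging => //; split; exact: perturbation_tangent.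
have d1P (x1 x2 x3 : R -> R) t z : derivable x1 t 1 -> derivable x2 t 1 ->
    derivable (fun s => P (vec3 (x1 s) (x2 s) (x3 s))) t 1 /\
    ((fun s => P (vec3 (x1 s) (x2 s) (x3 s)))^`())%classic t =
      P (vec3 ((x1^`())%classic t) ((x2^`())%classic t) z).
  move=> /derivableP dx1 /derivableP dx2.
  have [dd dE] := dP x1 x2 x3 t _ _ z dx1 dx2.
  by split; [exact: dd | rewrite !derive1E; exact: dE].
split; first by have [] := is_diff_routh_acc_hanging hrho m g hJ.
split=> //; split.
  move=> [u1 u2] /tangent_TS2_hanging [/= u10 u20].
  exists (M^T *m cross3 u1 (hanging rho)), (M^T *m cross3 u2 (hanging rho)).
  by rewrite /P !perturbation_onto.
split=> //; split=> // x1 x2 x3.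
set d := fun t => P _.
(* The third velocity coordinate is free; fixing it to 0 presents d' as a curve of the same form as
   [d], so the same lemmas apply to the second derivative. *)
have d'E : (forall t, derivable x1 t 1) -> (forall t, derivable x2 t 1) ->
    d^`()%classic = fun t => P (vec3 (x1^`()%classic t) (x2^`()%classic t) 0).
  move=> dx1 dx2; apply/funext => t.
  by have [] := d1P x1 x2 x3 t 0 (dx1 t) (dx2 t).
have accE t v : 'd (routh_acc m g J rho 0) p (d t, P v) =
    P (vec3 (- (m * g * l1 * x1 t)) (- (m * g * l2 * x2 t)) 0).
  rewrite [LHS]DF; apply/P_eqP.
  by split; rewrite mxE stiffness_coordE !mxE.
split=> [H | [H1 H2] t].
  (* A linearized solution only asserts regularity of [d] and d'; that of the coordinates is
     extracted from it. *)
  have dx t : derivable x1 t 1 /\ derivable x2 t 1.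
    by have [_ + _ _] := H t; exact: derP.
  have dE := d'E (fun t => (dx t).1) (fun t => (dx t).2).
  have ddx t : derivable (x1^`()%classic) t 1 /\ derivable (x2^`()%classic) t 1.
    by have [_ _ + _] := H t; rewrite dE; exact: derP.
  have osc t : (x1^`()^`())%classic t = - (m * g * l1 * x1 t) /\
      (x2^`()^`())%classic t = - (m * g * l2 * x2 t).
    have [_ _ _] := H t; rewrite dE accE.
    have [_ ->] := d1P _ _ (fun=> 0) t 0 (ddx t).1 (ddx t).2.
    (* Both accelerations are now images under [P], so the first two coordinates can be equated. *)
    by move=> /P_eqP; rewrite !mxE.
  split=> t; split; rewrite ?(osc t).1 ?(osc t).2 ?addNr //.
  - by have [] := dx t.
  - by have [] := ddx t.
  - by have [] := dx t.
  - by have [] := ddx t.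
have dx1 s : derivable x1 s 1 by have [] := H1 s.
have dx2 s : derivable x2 s 1 by have [] := H2 s.
have dE := d'E dx1 dx2.
have [_ ddx1 /eqP] := H1 t; rewrite addr_eq0 => /eqP e1.
have [_ ddx2 /eqP] := H2 t; rewrite addr_eq0 => /eqP e2.
have [dd _] := d1P x1 x2 x3 t 0 (dx1 t) (dx2 t).
have [dd' d''E] := d1P _ _ (fun=> 0) t 0 ddx1 ddx2.
rewrite dE accE; split; [exact: P_tangent | exact: dd | exact: dd' |].
by rewrite -e1 -e2.
Qed.
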